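(* Let $\bar x\in X$ be a feasible point of (MPOC) where MPOC-MFCQ is valid. Then there exists a neighborhood $U\subset\mathbb R^n$ of $\bar x$ such that, for all $t>0$, MFCQ holds for the nonlinear program (P$(\varphi^t_{\mathrm{FB}})$) at all points from $X(\varphi^t_{\mathrm{FB}})\cap U$.
   Context: Let $n,m,p,q$ be positive integers, $\mathcal M:=\{1,\dots,m\}$, $\mathcal P:=\{1,\dots,p\}$, $\mathcal Q:=\{1,\dots,q\}$, and let $f,g_i,h_j,G_l,H_l\colon\mathbb R^n\to\mathbb R$ be continuously differentiable for all $i\in\mathcal M$, $j\in\mathcal P$, $l\in\mathcal Q$. The program (MPOC) is: minimize $f(x)$ subject to $g_i(x)\le 0$ ($i\in\mathcal M$), $h_j(x)=0$ ($j\in\mathcal P$), and ($G_l(x)\le 0$ or $H_l(x)\le 0$) for all $l\in\mathcal Q$. Its feasible set is $X$. For $t\ge0$ the smoothed Fischer--Burmeister function is $\varphi^t_{\mathrm{FB}}(a,b):=a+b-\sqrt{a^2+b^2+2t}$, $(a,b)\in\mathbb R^2$. The relaxed program (P$(\varphi^t_{\mathrm{FB}})$) is: minimize $f(x)$ subject to $g_i(x)\le 0$ ($i\in\mathcal M$), $h_j(x)=0$ ($j\in\mathcal P$), $\varphi^t_{\mathrm{FB}}(G_l(x),H_l(x))\le0$ ($l\in\mathcal Q$); its feasible set is $X(\varphi^t_{\mathrm{FB}})$. A union of families $\{v^i\}_{i=1}^r\cup\{w^j\}_{j=1}^s$ of vectors is positive-linearly independent if $\sum_i\alpha_iv^i+\sum_j\beta_jw^j=0$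 with $\alpha_i\ge0$, $\beta_j\in\mathbb R$ forces all $\alpha_i,\beta_j$ to vanish. For a smooth nonlinear program with constraints $c_i\le0$, $h_j=0$, MFCQ holds at a feasible point $x$ if $\{\nabla c_i(x): c_i(x)=0\}\cup\{\nabla h_j(x)\}_j$ is positive-linearly independent (nonnegative coefficients for the active $\nabla c_i(x)$, free coefficients for the $\nabla h_j(x)$). For $\bar x\in X$ put $I^g(\bar x):=\{i\in\mathcal M: g_i(\bar x)=0\}$, $I^{0+}(\bar x):=\{l\in\mathcal Q: G_l(\bar x)=0,\ H_l(\bar x)>0\}$, $I^{+0}(\bar x):=\{l\in\mathcal Q: G_l(\bar x)>0,\ H_l(\bar x)=0\}$, $I^{00}(\bar x):=\{l\in\mathcal Q: G_l(\bar x)=0,\ H_l(\bar x)=0\}$. MPOC-MFCQ holds at $\bar x\in X$ if the family $$\bigl[\{\nabla g_i(\bar x)\}_{i\in I^g(\bar x)}\cup\{\nabla G_l(\bar x)\}_{l\in I^{0+}(\bar x)\cup I^{00}(\bar x)}\cup\{\nabla H_l(\bar x)\}_{l\in I^{+0}(\bar x)\cup I^{00}(\bar x)}\bigr]\cup\{\nabla h_j(\bar x)\}_{j\in\mathcal P}$$ is positive-linearly independent (bracketed vectors get nonnegative coefficients, the $\nabla h_j(\bar x)$ get free coefficients). *)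

(* Defs.v *)
From mathcomp Require Import all_boot all_order all_algebra.
From mathcomp Require Import all_classical all_reals all_analysis.

Set Implicit Arguments.
Unset Strict Implicit.
Unset Printing Implicit Defensive.

Import Order.TTheory GRing.Theory Num.Theory.
Import numFieldNormedType.Exports.
Local Open Scope classical_set_scope.
Local Open Scope ring_scope.

Definition grad (R : realType) (n : nat) (f : 'rV[R]_n -> R) (x : 'rV[R]_n) :
    'rV[R]_n :=
  \row_i 'D_(delta_mx 0 i) f x.

Definition C1 (R : realType) (n : nat) (f : 'rV[R]_n -> R) : Prop :=
  (forall x : 'rV[R]_n, differentiable f x) /\ continuous (grad f).

(* Positive-linear independence of {v i | i in A} U {w j}. The families are
   indexed, so repeated vectors get separate coefficients. The values of alpha
   outside A are irrelevant. *)
Definition pos_lin_indep (R : realType) (n : nat) (I J : finType)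
    (A : pred I) (v : I -> 'rV[R]_n) (w : J -> 'rV[R]_n) : Prop :=
  forall (alpha : I -> R) (beta : J -> R),
    (forall i, A i -> 0 <= alpha i) ->
    \sum_(i | A i) alpha i *: v i + \sum_j beta j *: w j = 0 ->
    (forall i, A i -> alpha i = 0) /\ (forall j, beta j = 0).

(* minimize nlp_obj subject to nlp_ineq i <= 0 and nlp_eq j = 0 *)
Record nlp (R : realType) (n : nat) (I J : finType) := NLP {
  nlp_obj : 'rV[R]_n -> R ;
  nlp_ineq : I -> 'rV[R]_n -> R ;
  nlp_eq : J -> 'rV[R]_n -> R }.

Definition nlp_feasible (R : realType) (n : nat) (I J : finType)
    (P : nlp R n I J) : set 'rV[R]_n :=
  [set x | (forall i, nlp_ineq P i x <= 0) /\ (forall j, nlp_eq P j x = 0)].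

Definition MFCQ (R : realType) (n : nat) (I J : finType) (P : nlp R n I J)
    (x : 'rV[R]_n) : Prop :=
  pos_lin_indep (fun i => nlp_ineq P i x == 0)
    (fun i => grad (nlp_ineq P i) x) (fun j => grad (nlp_eq P j) x).

(* minimize obj subject to g i <= 0, h j = 0 and (G l <= 0 or H l <= 0) *)
Record mpoc (R : realType) (n m p q : nat) := MPOC {
  obj : 'rV[R]_n -> R ;
  g : 'I_m -> 'rV[R]_n -> R ;
  h : 'I_p -> 'rV[R]_n -> R ;
  G : 'I_q -> 'rV[R]_n -> R ;
  H : 'I_q -> 'rV[R]_n -> R }.

Section mpoc_theory.
Variables (R : realType) (n m p q : nat) (P : mpoc R n m p q).
Implicit Types (x : 'rV[R]_n) (l : 'I_q).

Definition mpoc_C1 : Prop :=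
  [/\ C1 (obj P), forall i, C1 (g P i), forall j, C1 (h P j),
      forall l, C1 (G P l) & forall l, C1 (H P l)].

Definition mpoc_feasible : set 'rV[R]_n :=
  [set x | [/\ forall i, g P i x <= 0, forall j, h P j x = 0 &
               forall l, G P l x <= 0 \/ H P l x <= 0]].

Definition Ig x : pred 'I_m := fun i => g P i x == 0.
Definition I0plus x : pred 'I_q := fun l => (G P l x == 0) && (0 < H P l x).
Definition Iplus0 x : pred 'I_q := fun l => (0 < G P l x) && (H P l x == 0).
Definition I00 x : pred 'I_q := fun l => (G P l x == 0) && (H P l x == 0).

(* The three bracketed families are indexed by a disjoint sum, so that for
   l in I00 the gradients of G l and H l both occur. *)
Definition MPOC_MFCQ x : Prop :=
  pos_lin_indep
    (fun k : 'I_m + ('I_q + 'I_q) =>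
       match k with
       | inl i => Ig x i
       | inr (inl l) => I0plus x l || I00 x l
       | inr (inr l) => Iplus0 x l || I00 x l
       end)
    (fun k =>
       match k with
       | inl i => grad (g P i) x
       | inr (inl l) => grad (G P l) x
       | inr (inr l) => grad (H P l) x
       end)
    (fun j => grad (h P j) x).

Definition phiFB (t a b : R) : R :=
  a + b - Num.sqrt (a ^+ 2 + b ^+ 2 + 2 * t).

Definition relaxed_FB (t : R) : nlp R n ('I_m + 'I_q)%type 'I_p :=
  NLP (obj P)
    (fun k =>
       match k with
       | inl i => g P i
       | inr l => fun x => phiFB t (G P l x) (H P l x)
       end)
    (h P).

End mpoc_theory.

(* Main.v *)
Require Import Defs.
From mathcomp Require Import all_boot all_order all_algebra.
From mathcomp Require Import all_classical all_reals all_analysis.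
From mathcomp Require Import ring lra.

(** Two facts carry the proof.

    First, positive-linear independence of a finite family is an open condition
    on its vectors ([near_pos_lin_indep]).  The admissible coefficients form a
    closed cone, which is determined by its intersection with the unit sphere;
    that intersection is compact, so a linear combination which vanishes
    nowhere on it still vanishes nowhere on it after a small perturbation of
    the vectors.

    Second, at a point [x] where the relaxed constraint [l] is active, both
    [a := G l x] and [b := H l x] are positive and the gradient of the
    constraint is the convex combination
    [b / (a + b) *: grad (G l) x + a / (a + b) *: grad (H l) x]
    ([phiFB_eq0], [grad_phiFB]).  The weights have no limit as [x] tends to
    [xbar] and [t] to 0 when [l] is biactive at [xbar], so these gradients are
    not small perturbations of a fixed family.  They are, however, nonnegative
    combinations of vectors that are:
    - if [G l xbar = 0 < H l xbar], the gradient is [b / (a + b)] times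
      [grad (G l) x + (a / b) *: grad (H l) x], and [a / b] tends to 0, so this
      vector tends to [grad (G l) xbar];
    - the case [H l xbar = 0 < G l xbar] is symmetric;
    - if both vanish at [xbar], the gradient is a combination of
      [grad (G l) x] and [grad (H l) x], and both vectors occur in the family
      of MPOC-MFCQ.
    No other case arises near [xbar]: a function negative at [xbar] stays
    negative nearby, and feasibility of [xbar] excludes [G l] and [H l] both
    positive there.  The vectors so obtained ([tilted_grad]) depend on [x] only,
    not on [t], which is why one neighborhood serves every [t > 0].  A vanishing
    combination of the active gradients of the relaxed program is thus a
    vanishing combination of a positive-linearly independent family, and its
    coefficients vanish because at least one of the positive weights
    [b / (a + b)], [a / (a + b)] multiplies each of them. *)

Set Implicit Arguments.
Unset Strict Implicit.
Unset Printing Implicit Defensive.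

Import Order.TTheory GRing.Theory Num.Theory.
Import numFieldNormedType.Exports.
Local Open Scope classical_set_scope.
Local Open Scope ring_scope.

(** * Stability of positive-linear independence *)

Lemma cvg_lincomb (R : realType) (N n : nat) (T : Type) (F : set_system T)
    {FF : Filter F} (c : T -> 'rV[R]_N) (c0 : 'rV[R]_N)
    (V : 'I_N -> T -> 'rV[R]_n) (v : 'I_N -> 'rV[R]_n) :
  c @ F --> c0 -> (forall k, V k @ F --> v k) ->
  \sum_k c y 0 k *: V k y @[y --> F] --> \sum_k c0 0 k *: v k.
Proof.
move=> cc0 Vv; apply: cvg_big; first exact: add_continuous.
move=> k _; apply: cvgZ; last exact: Vv.
exact: (@cvg_comp _ _ _ c (fun M : 'rV[R]_N => M 0 k) _ _ _ cc0
  (@coord_continuous R 1 N 0 k c0)).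
Qed.

(** A linear map with trivial kernel on a closed cone keeps this property under
    small perturbations.  By homogeneity it suffices to control the unit vectors
    of the cone; they form a compact set, so the joint continuity of
    [c, y |-> \sum_k c 0 k *: V k y] at each of them gives one neighborhood
    in [y] that serves all. *)
Lemma near_cone_kernel_trivial (R : realType) (N n : nat) (C : set 'rV[R]_N)
    (T : Type) (F : set_system T) {FF : Filter F}
    (V : 'I_N -> T -> 'rV[R]_n) (v : 'I_N -> 'rV[R]_n) :
  closed C -> (forall a c, 0 < a -> C c -> C (a *: c)) ->
  (forall k, V k @ F --> v k) ->
  (forall c, C c -> \sum_k c 0 k *: v k = 0 -> c = 0) ->
  \forall y \near F, forall c, C c -> \sum_k c 0 k *: V k y = 0 -> c = 0.
Proof.
move=> Ccl Ccone Vv v_inj.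
pose K := C `&` [set c : 'rV[R]_N | `|c| = 1].
have Kcpt : compact K.
  apply: bounded_closed_compact.
    exists 1; split; first exact: num_real.
    by move=> M M1 c [_ /= ->]; exact: ltW.
  apply: closedI => //.
  have -> : [set c : 'rV[R]_N | `|c| = 1] =
      (fun c : 'rV[R]_N => `|c|) @^-1` [set 1] by [].
  apply: preimage_closed; first by move=> c _; exact: norm_continuous.
  exact: closed_eq.
have /compact_near_coveringP /(_ _ F
  (fun y (c : 'rV[R]_N) => \sum_k c 0 k *: V k y != 0) FF) cov := Kcpt.
have /cov : forall c, K c ->
    \forall c' \near c & y \near F, \sum_k (c' : 'rV[R]_N) 0 k *: V k y != 0.
  move=> c [Cc c1].
  have c_neq0 : \sum_k c 0 k *: v k != 0.
    apply/eqP => /(v_inj c Cc) c0.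
    by move: c1; rewrite /= c0 normr0 => /esym/eqP; rewrite oner_eq0.
  have FFc : Filter (filter_prod (nbhs c) F) by exact: filter_prod_filter.
  have cv : \sum_k (z.1 : 'rV[R]_N) 0 k *: V k z.2 @[z --> filter_prod (nbhs c) F]
      --> \sum_k c 0 k *: v k.
    apply: cvg_lincomb; first exact: cvg_fst.
    by move=> k; exact: (cvg_comp _ _ cvg_snd (Vv k)).
  exact: (cvgr_neq0 _ cv).
apply: filterS => y Ky c Cc cV0; apply/eqP; apply: contraT => c_neq0.
have c_gt0 : 0 < `|c| by rewrite normr_gt0.
have /Ky : K (`|c|^-1 *: c).
  split; first by apply: Ccone; rewrite ?invr_gt0.
  by rewrite /= normrZ normfV normr_id mulVf ?gt_eqF.
suff -> : \sum_k (`|c|^-1 *: c) 0 k *: V k y = 0 by rewrite eqxx.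
transitivity (`|c|^-1 *: (\sum_k c 0 k *: V k y)).
  rewrite scaler_sumr.
  by apply: eq_bigr => k _; rewrite mxE scalerA.
by rewrite cV0 scaler0.
Qed.

Section pos_lin_indep_row.
Variables (R : realType) (n : nat) (I J : finType) (A : pred I).

(** The coefficients of both families are stored in one row, where closed bounded
    sets are compact.  Entries of inequality indices outside [A] are set to 0,
    so that a row of the cone vanishes as soon as its meaningful entries do. *)
Definition coef_cone : set 'rV[R]_#|{: I + J}| :=
  [set c : 'rV[R]_#|{: I + J}| | forall i,
     if A i then is_true (0 <= c 0 (enum_rank (inl i)))
     else c 0 (enum_rank (inl i)) = 0].

Definition union_family (v : I -> 'rV[R]_n) (w : J -> 'rV[R]_n)
    (k : 'I_#|{: I + J}|) : 'rV[R]_n :=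
  match enum_val k with
  | inl i => if A i then v i else 0
  | inr j => w j
  end.

Lemma sum_union_family v w (c : 'rV[R]_#|{: I + J}|) :
  \sum_k c 0 k *: union_family v w k =
  \sum_(i | A i) c 0 (enum_rank (inl i)) *: v i +
  \sum_j c 0 (enum_rank (inr j)) *: w j.
Proof.
rewrite (reindex (@enum_rank {: I + J})) /=; last first.
  by exists enum_val => k _; rewrite ?enum_valK ?enum_rankK.
rewrite big_sumType /=; congr (_ + _).
  rewrite [RHS]big_mkcond; apply: eq_bigr => i _.
  by rewrite /union_family enum_rankK; case: ifP => // _; rewrite scaler0.
by apply: eq_bigr => j _; rewrite /union_family enum_rankK.
Qed.

Lemma pos_lin_indepP v w :
  pos_lin_indep A v w <->
  forall c, coef_cone c -> \sum_k c 0 k *: union_family v w k = 0 -> c = 0.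
Proof.
split=> [indep c Cc | indep alpha beta alpha_ge0 sum0].
  rewrite sum_union_family => /(indep (fun i => c 0 (enum_rank (inl i)))
    (fun j => c 0 (enum_rank (inr j)))) [].
    by move=> i Ai; have := Cc i; rewrite Ai.
  move=> c0l c0r; apply/rowP => k; rewrite mxE -(enum_valK k).
  case: (enum_val k) => [i|j]; last exact: c0r.
  by have := Cc i; case: ifP => // Ai _; exact: c0l.
pose c : 'rV[R]_#|{: I + J}| := \row_k
  match enum_val k with inl i => if A i then alpha i else 0
                      | inr j => beta j end.
have c_inl i : c 0 (enum_rank (inl i)) = if A i then alpha i else 0.
  by rewrite mxE enum_rankK.
have c_inr j : c 0 (enum_rank (inr j)) = beta j by rewrite mxE enum_rankK.
have c0 : c = 0.
  apply: indep; first by move=> i; have := c_inl i; case: ifP => // Ai ->; exact: alpha_ge0.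
  rewrite sum_union_family -[RHS]sum0; congr (_ + _).
    by apply: eq_bigr => i Ai; rewrite c_inl Ai.
  by apply: eq_bigr => j _; rewrite c_inr.
split=> [i Ai|j].
  by have := c_inl i; rewrite Ai c0 mxE.
by have := c_inr j; rewrite c0 mxE.
Qed.

Lemma closed_coef_cone : closed coef_cone.
Proof.
have -> : coef_cone = \bigcap_(i in [set: I])
    (fun c : 'rV[R]_#|{: I + J}| => c 0 (enum_rank (inl i))) @^-1`
      (if A i then [set a : R | 0 <= a] else [set a | a = 0]).
  apply/seteqP; split=> c Cc i; last by have := Cc i Logic.I; rewrite /preimage /=; case: ifP.
  by move=> _; have := Cc i; rewrite /preimage /=; case: ifP.
apply: closed_bigI => i _; apply: preimage_closed.
  by move=> c _; exact: coord_continuous.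
by case: ifP => _; [exact: closed_ge | exact: closed_eq].
Qed.

Lemma coef_coneZ a c : 0 < a -> coef_cone c -> coef_cone (a *: c).
Proof.
move=> a_gt0 Cc i; have := Cc i; rewrite mxE; case: ifP => _; last first.
  by move=> ->; rewrite mulr0.
by move=> ?; rewrite mulr_ge0 // ltW.
Qed.

(** Positive-linear independence is the triviality of a kernel on the closed cone
    [coef_cone], hence an open condition. *)
Lemma near_pos_lin_indep (T : Type) (F : set_system T) {FF : Filter F}
    (V : I -> T -> 'rV[R]_n) (W : J -> T -> 'rV[R]_n)
    (v : I -> 'rV[R]_n) (w : J -> 'rV[R]_n) :
  (forall i, A i -> V i @ F --> v i) -> (forall j, W j @ F --> w j) ->
  pos_lin_indep A v w ->
  \forall y \near F, pos_lin_indep A (V ^~ y) (W ^~ y).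
Proof.
move=> Vv Ww /pos_lin_indepP indep.
have fam k : union_family (V ^~ y) (W ^~ y) k @[y --> F]
    --> union_family v w k.
  rewrite /union_family; case: (enum_val k) => [i|j]; last exact: Ww.
  by case: ifP => [/Vv//|_]; exact: cvg_cst.
have := @near_cone_kernel_trivial _ _ _ _ _ F FF _ _ closed_coef_cone
  coef_coneZ fam indep.
by apply: filterS => y ?; apply/pos_lin_indepP.
Qed.

End pos_lin_indep_row.

(** * The active smoothed Fischer-Burmeister constraint *)

(** Squaring [a + b = Num.sqrt (a ^+ 2 + b ^+ 2 + 2 * t)] gives [a * b = t > 0],
    while [a + b] is nonnegative as a square root. *)
Lemma phiFB_eq0 (R : realType) (t a b : R) : 0 < t -> phiFB t a b = 0 ->
  [/\ 0 < a, 0 < b & Num.sqrt (a ^+ 2 + b ^+ 2 + 2 * t) = a + b].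
Proof.
rewrite /phiFB => t_gt0 /eqP; rewrite subr_eq0 => /eqP abE.
have r_ge0 : 0 <= a ^+ 2 + b ^+ 2 + 2 * t.
  by rewrite !addr_ge0 ?sqr_ge0 // mulr_ge0 // ltW.
have ab_ge0 : 0 <= a + b by rewrite abE sqrtr_ge0.
have : (a + b) ^+ 2 = a ^+ 2 + b ^+ 2 + 2 * t by rewrite abE sqr_sqrtr.
rewrite sqrrD => sq.
have abt : a * b = t by lra.
by split=> //; nra.
Qed.

(** The partial derivatives of [phiFB t] at [(a, b)] are [1 - a / s] and
    [1 - b / s], with [s] the value of the square root; on the zero set
    [s = a + b] turns them into the weights of a convex combination. *)
Lemma grad_phiFB (R : realType) (n : nat) (t : R) (G H : 'rV[R]_n -> R) x :
  0 < t -> differentiable G x -> differentiable H x ->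
  phiFB t (G x) (H x) = 0 ->
  grad (fun y => phiFB t (G y) (H y)) x =
  (H x / (G x + H x)) *: grad G x + (G x / (G x + H x)) *: grad H x.
Proof.
move=> t_gt0 dG dH /(phiFB_eq0 t_gt0) [a_gt0 b_gt0 sE].
apply/rowP => i; rewrite !mxE; set e := delta_mx _ _.
have iG : is_derive x e G ('D_e G x) by apply/derivableP/diff_derivable.
have iH : is_derive x e H ('D_e H x) by apply/derivableP/diff_derivable.
pose u : 'rV[R]_n -> R := G ^+ 2 + H ^+ 2 + cst (2 * t).
have uE y : u y = G y ^+ 2 + H y ^+ 2 + 2 * t by [].
have iu : is_derive x e u (2 * G x * 'D_e G x + 2 * H x * 'D_e H x).
  apply: is_derive_eq; rewrite !expr1 addr0 /GRing.scale /=; ring.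
have du : differentiable u x.
  apply: differentiableD; last exact: differentiable_cst.
  by apply: differentiableD; exact: differentiableX.
have u_gt0 : 0 < u x.
  by rewrite uE; have := sqr_ge0 (G x); have := sqr_ge0 (H x); lra.
have ds : differentiable (Num.sqrt : R -> R) (u x).
  by apply/derivable1_diffP/(@ex_derive _ _ _ _ _ _ _ (is_derive1_sqrt u_gt0)).
have isq : is_derive x e (Num.sqrt \o u)
    ((2 * G x * 'D_e G x + 2 * H x * 'D_e H x) / (2 * Num.sqrt (u x))).
  apply: DeriveDef; first by apply: diff_derivable; exact: differentiable_comp.
  rewrite deriveE; last exact: differentiable_comp.
  rewrite diff_comp //= deriv1E; last exact/derivable1_diffP.
  by rewrite -(deriveE _ du) derive1E derive_sqrt // derive_val.
have iphi := is_deriveB (is_deriveD iG iH) isq.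
rewrite [LHS](@derive_val _ _ _ _ _ _ _ iphi) uE sE; field.
by rewrite gt_eqF // addr_gt0.
Qed.

(** * Gradients that converge at the reference point *)

Lemma C1_continuous (R : realType) (n : nat) (f : 'rV[R]_n -> R) :
  C1 f -> continuous f.
Proof. by move=> [df _] x; exact: differentiable_continuous. Qed.

(** When [b] holds, this is the gradient of the active constraint built from [f1]
    and [f2], divided by its weight on [grad f1 x]. *)
Definition tilted_grad (R : realType) (n : nat) (b : bool)
    (f1 f2 : 'rV[R]_n -> R) (x : 'rV[R]_n) : 'rV[R]_n :=
  grad f1 x + (if b then f1 x / f2 x else 0) *: grad f2 x.

Lemma cvg_tilted_grad (R : realType) (n : nat) (b : bool)
    (f1 f2 : 'rV[R]_n -> R) (x : 'rV[R]_n) :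
  C1 f1 -> C1 f2 -> (b -> f1 x = 0 /\ f2 x != 0) ->
  tilted_grad b f1 f2 @ x --> grad f1 x.
Proof.
move=> c1 c2 b0; rewrite -[X in _ --> X]addr0 -(scale0r (grad f2 x)).
apply: (cvgD (c1.2 x)); apply: cvgZ (c2.2 x).
case: b b0 => [/(_ isT) [f1x f2x]|_]; last exact: cvg_cst.
have := cvgM (@C1_continuous _ _ _ c1 x) (cvgV f2x (@C1_continuous _ _ _ c2 x)).
by rewrite f1x mul0r; apply; exact: nbhs_filter.
Qed.

(** * MFCQ for the relaxed program *)

Theorem proposition5p3 (R : realType) (n m p q : nat)
    (n_gt0 : (0 < n)%N) (m_gt0 : (0 < m)%N)
    (p_gt0 : (0 < p)%N) (q_gt0 : (0 < q)%N)
    (P : mpoc R n m p q) (P_C1 : mpoc_C1 P) (xbar : 'rV[R]_n)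
    (xbar_feasible : mpoc_feasible P xbar)
    (xbar_MFCQ : MPOC_MFCQ P xbar) :
  exists U : set 'rV[R]_n, nbhs xbar U /\
    forall t : R, 0 < t ->
      forall x : 'rV[R]_n, (nlp_feasible (relaxed_FB P t) `&` U) x ->
        MFCQ (relaxed_FB P t) x.
Proof.
case: P_C1 => _ g_C1 h_C1 G_C1 H_C1.
case: xbar_feasible => g_le0 _ GH_le0.
pose A (k : 'I_m + ('I_q + 'I_q)) := match k with
  | inl i => Ig P xbar i
  | inr (inl l) => I0plus P xbar l || I00 P xbar l
  | inr (inr l) => Iplus0 P xbar l || I00 P xbar l
  end.
pose V (k : 'I_m + ('I_q + 'I_q)) := match k with
  | inl i => grad (g P i)
  | inr (inl l) => tilted_grad (I0plus P xbar l) (G P l) (H P l)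
  | inr (inr l) => tilted_grad (Iplus0 P xbar l) (H P l) (G P l)
  end.
pose stays_neg (f : 'rV[R]_n -> R) x := f xbar < 0 -> f x < 0.
have near_stays_neg f : C1 f -> \forall x \near xbar, stays_neg f x.
  move=> /C1_continuous /(_ xbar) f_cvg; case: (ltP (f xbar) 0) => f0.
    by near=> x => _; near: x; exact: (cvgr_lt _ f_cvg).
  by near=> x => /(le_lt_trans f0); rewrite ltxx.
have indep : \forall x \near xbar,
    pos_lin_indep A (V ^~ x) (fun j => grad (h P j) x).
  have stable := @near_pos_lin_indep R n _ _ A _ (nbhs xbar)
    (nbhs_filter xbar) V (fun j => grad (h P j)) _ _ _ _ xbar_MFCQ.
  apply: stable; last by move=> j; exact: (h_C1 j).2.
  move=> [i|[l|l]] _; first exact: (g_C1 i).2.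
    by apply: cvg_tilted_grad => // /andP[/eqP ? /gt_eqF ->].
  by apply: cvg_tilted_grad => // /andP[/gt_eqF -> /eqP ?].
exists [set x | [/\ pos_lin_indep A (V ^~ x) (fun j => grad (h P j) x),
  forall i, stays_neg (g P i) x, forall l, stays_neg (G P l) x
  & forall l, stays_neg (H P l) x]]; split.
  near=> x; split; near: x => //;
    by apply: filter_forall => k; exact: near_stays_neg.
move=> t t_gt0 x [_ [indep_x g_neg G_neg H_neg]] alpha beta alpha_ge0.
rewrite /MFCQ /= in alpha_ge0 *.
pose a l := G P l x; pose b l := H P l x.
pose act l := phiFB t (a l) (b l) == 0.
have act_gt0 l : act l -> 0 < a l /\ 0 < b l.
  by move=> /eqP /(phiFB_eq0 t_gt0) [].
have weight_gt0 l : act l ->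
    0 < b l / (a l + b l) /\ 0 < a l / (a l + b l).
  by move=> /act_gt0 [aP bP]; rewrite !divr_gt0 ?addr_gt0.
have act_g i : g P i x == 0 -> Ig P xbar i.
  move=> /eqP gx; rewrite /Ig eq_le g_le0 leNgt; apply/negP => /g_neg.
  by rewrite gx ltxx.
have act_cases l : act l ->
    [\/ [/\ I0plus P xbar l, ~~ Iplus0 P xbar l & ~~ I00 P xbar l],
        [/\ ~~ I0plus P xbar l, Iplus0 P xbar l & ~~ I00 P xbar l]
      | [/\ ~~ I0plus P xbar l, ~~ Iplus0 P xbar l & I00 P xbar l]].
  move=> /act_gt0 [aP bP].
  have Gge0 : 0 <= G P l xbar.
    by rewrite leNgt; apply/negP => /G_neg; rewrite ltNge (ltW aP).
  have Hge0 : 0 <= H P l xbar.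
    by rewrite leNgt; apply/negP => /H_neg; rewrite ltNge (ltW bP).
  rewrite /I0plus /Iplus0 /I00 !lt_neqAle Gge0 Hge0 !andbT ![0 == _]eq_sym.
  have : (G P l xbar == 0) || (H P l xbar == 0).
    by rewrite !eq_le Gge0 Hge0 !andbT; apply/orP; exact: GH_le0.
  case: (G P l xbar == 0); case: (H P l xbar == 0) => //= _.
  - exact: Or33.
  - exact: Or31.
  - exact: Or32.
(* The multipliers alpha of the relaxed program, distributed over the family V;
   constraints that are inactive at x get coefficient 0. *)
pose gam (k : 'I_m + ('I_q + 'I_q)) : R := match k with
  | inl i => if g P i x == 0 then alpha (inl i) else 0
  | inr (inl l) => if act l then alpha (inr l) * (b l / (a l + b l)) else 0
  | inr (inr l) => if act l then alpha (inr l) * (a l / (a l + b l)) else 0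
  end.
have gam_ge0 k : A k -> 0 <= gam k.
  case: k => [i|[l|l]] _ /=; case: ifP => // act_k; first exact: alpha_ge0.
    by rewrite mulr_ge0 ?alpha_ge0 // ltW //; case: (weight_gt0 l act_k).
  by rewrite mulr_ge0 ?alpha_ge0 // ltW //; case: (weight_gt0 l act_k).
move=> sum0.
have := indep_x gam beta gam_ge0.
case.
  rewrite -[RHS]sum0; congr (_ + _).
  rewrite !big_sumType /=; congr (_ + _).
    rewrite big_mkcond [RHS]big_mkcond; apply: eq_bigr => i _ /=.
    case: ifP => [_|nIg]; last by case: ifP => // /act_g; rewrite nIg.
    by case: ifP => _; rewrite ?scale0r.
  rewrite big_mkcond [X in _ + X]big_mkcond -big_split [RHS]big_mkcond /=.
  apply: eq_bigr => l _; rewrite -/(a l) -/(b l) -/(act l).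
  case actl: (act l); last by rewrite !scale0r !if_same addr0.
  have [aP bP] := act_gt0 l actl.
  rewrite (grad_phiFB t_gt0 (proj1 (G_C1 l) x) (proj1 (H_C1 l) x));
    last exact/eqP.
  rewrite /tilted_grad -/(a l) -/(b l).
  have sN0 : a l + b l != 0 by rewrite gt_eqF // addr_gt0.
  have aN0 : a l != 0 by rewrite gt_eqF.
  have bN0 : b l != 0 by rewrite gt_eqF.
  (* In each case the index set A selects, for this l, exactly the vectors of
     V whose combination is the gradient of the constraint. *)
  case: (act_cases l actl) => -[];
    do 3 (first [move=> -> | move=> /negbTE ->]);
    by apply/rowP => i; rewrite !mxE /=; field; rewrite ?sN0 ?aN0 ?bN0.
move=> gam0 beta0; split=> // -[i|l] /= act_k.
  by have := gam0 (inl i) (act_g i act_k); rewrite /= act_k.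
have [wG wH] := weight_gt0 l act_k.
have cancel w : 0 < w -> alpha (inr l) * w = 0 -> alpha (inr l) = 0.
  by move=> w_gt0 /eqP; rewrite mulf_eq0 (gt_eqF w_gt0) orbF => /eqP.
have gamG : I0plus P xbar l || I00 P xbar l -> alpha (inr l) = 0.
  by move=> /(gam0 (inr (inl l))); rewrite /= [act l]act_k; exact: cancel.
have gamH : Iplus0 P xbar l || I00 P xbar l -> alpha (inr l) = 0.
  by move=> /(gam0 (inr (inr l))); rewrite /= [act l]act_k; exact: cancel.
case: (act_cases l act_k) => -[lG lH l0].
- by apply: gamG; rewrite lG.
- by apply: gamH; rewrite lH.
- by apply: gamG; rewrite l0 orbT.
Unshelve. all: end_near.
Qed.
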